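(* Let $r\ge 2$. In type $B_r$, let $\mathcal B_r(\tilde\alpha,\varpi_1)=\{\sigma\in W:\wp(\sigma(\tilde\alpha+\rho)-(\varpi_1+\rho))>0\}$, where $\tilde\alpha$ is the highest root and $\varpi_1=\alpha_1+\cdots+\alpha_r$. Then $|\mathcal B_r(\tilde\alpha,\varpi_1)|=F_r$, where $F_r$ is the $r$-th Fibonacci number ($F_1=F_2=1$, $F_n=F_{n-1}+F_{n-2}$).
   Context: Type $B_r$ ($\mathfrak{so}_{2r+1}(\mathbb C)$): simple roots $\alpha_i=\varepsilon_i-\varepsilon_{i+1}$ for $1\le i\le r-1$ and $\alpha_r=\varepsilon_r$; positive roots $\Phi^+=\{\varepsilon_i-\varepsilon_j,\varepsilon_i+\varepsilon_j:1\le i<j\le r\}\cup\{\varepsilon_i:1\le i\le r\}$; highest root $\tilde\alpha=\alpha_1+2\alpha_2+\cdots+2\alpha_r$; $\rho=\frac12\sum_{\alpha\in\Phi^+}\alpha$; $W$ is the Weyl group. $\wp(\xi)$ is Kostant's partition function: the number of ways $\xi$ may be written as a nonnegative integral sum of positive roots. *)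

(* Defs.v *)
From HB Require Import structures.
From mathcomp Require Import all_boot all_order all_algebra finmap.
From mathcomp Require Import boolp classical_sets functions cardinality.

Set Implicit Arguments.
Unset Strict Implicit.
Unset Printing Implicit Defensive.

Import Order.TTheory GRing.Theory Num.Theory.
Local Open Scope fset_scope.
Local Open Scope ring_scope.

(* Everything in sight (roots, rho, weights, reflections) is rational, so we
   work in the rational form of the dual Cartan subalgebra, with orthonormal
   basis eps_1, ..., eps_r.  Indices are 0-based: [eps r i] is eps_(i+1). *)
Definition eps (r i : nat) : 'rV[rat]_r := \row_(j < r) (j == i :> nat)%:R.

Definition simple_root (r : nat) (i : 'I_r) : 'rV[rat]_r :=
  if i.+1 == r then eps r i else eps r i - eps r i.+1.

Definition pos_roots (r : nat) : {fset 'rV[rat]_r} :=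
  let lt_pairs := [pred p : 'I_r * 'I_r | (p.1 < p.2)%N] in
  [fset eps r p.1 - eps r p.2 | p : 'I_r * 'I_r in lt_pairs] `|`
  [fset eps r p.1 + eps r p.2 | p : 'I_r * 'I_r in lt_pairs] `|`
  [fset eps r i | i : 'I_r in 'I_r].

Definition highest_root (r : nat) : 'rV[rat]_r :=
  \sum_(i < r) simple_root i *+ (if i == 0%N :> nat then 1 else 2).

Definition varpi1 (r : nat) : 'rV[rat]_r := \sum_(i < r) simple_root i.

Definition rho (r : nat) : 'rV[rat]_r := 2^-1 *: \sum_(a : pos_roots r) val a.

Definition dot (r : nat) (u v : 'rV[rat]_r) : rat := \sum_(i < r) u 0 i * v 0 i.

Definition reflection (r : nat) (a v : 'rV[rat]_r) : 'rV[rat]_r :=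
  v - (2 * dot v a / dot a a) *: a.

(* The group generated by the reflections in all roots.  Positive roots suffice
   because a and - a define the same reflection, and no closure under inverses
   is needed because reflections are involutions. *)
Inductive weyl_group (r : nat) : set ('rV[rat]_r -> 'rV[rat]_r) :=
| weyl_id : weyl_group id
| weyl_reflection a w :
    a \in pos_roots r -> weyl_group w -> weyl_group (reflection a \o w).

Definition root_partitions (r : nat) (xi : 'rV[rat]_r) :
    set {ffun pos_roots r -> nat} :=
  [set c | \sum_(a : pos_roots r) val a *+ c a = xi]%classic.

(* Since [fset_set] is the empty set on infinite sets, the next definition
   relies on [root_partitions_finite] below. *)
Definition kostant (r : nat) (xi : 'rV[rat]_r) : nat :=
  #|` fset_set (root_partitions xi)|.

Definition alternation_set (r : nat) (lambda mu : 'rV[rat]_r) :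
    set ('rV[rat]_r -> 'rV[rat]_r) :=
  [set s | weyl_group s /\
           (0 < kostant (s (lambda + rho r) - (mu + rho r))%R)%N]%classic.

Fixpoint fib (n : nat) : nat :=
  match n with
  | 0 => 0
  | 1 => 1
  | (m.+1 as n').+1 => (fib n' + fib m)%N
  end.

(* A linear form that is at least 1 on every positive root bounds all
   multiplicities. *)
Definition level (r : nat) (v : 'rV[rat]_r) : rat :=
  \sum_(i < r) v 0 i * (r - i)%:R.

Lemma levelD r (u v : 'rV[rat]_r) : level (u + v) = level u + level v.
Proof.
by rewrite /level -big_split; apply: eq_bigr => i _; rewrite mxE mulrDl.
Qed.

Lemma levelN r (v : 'rV[rat]_r) : level (- v) = - level v.
Proof.
by rewrite /level -sumrN; apply: eq_bigr => i _; rewrite mxE mulNr.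
Qed.

Lemma level0 r : level (0 : 'rV[rat]_r) = 0.
Proof. by rewrite /level big1 // => i _; rewrite mxE mul0r. Qed.

Lemma levelMn r (v : 'rV[rat]_r) n : level (v *+ n) = level v *+ n.
Proof.
by elim: n => [|n IHn]; rewrite ?mulr0n ?level0 // !mulrS levelD IHn.
Qed.

Lemma level_eps r (i : 'I_r) : level (eps r i) = (r - i)%:R.
Proof.
rewrite /level (bigD1 i) //= mxE eqxx mul1r big1 ?addr0 // => j ji.
by rewrite mxE (val_eqE j i) (negbTE ji) mul0r.
Qed.

Lemma level_pos_roots r a : a \in pos_roots r -> 1 <= level a.
Proof.
have eps1 (i : 'I_r) : 1 <= level (eps r i).
  by rewrite level_eps ler1n subn_gt0.
rewrite !in_fsetU => /orP[/orP[]|] /imfsetP[/= p p12 ->]; last exact: eps1.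
- rewrite levelD levelN !level_eps lerBrDr -(natrD _ 1) ler_nat.
  by rewrite add1n ltn_sub2l.
- rewrite levelD -[leLHS]addr0 lerD //; exact: le_trans ler01 _.
Qed.

Lemma root_partitions_finite r (xi : 'rV[rat]_r) :
  finite_set (root_partitions xi).
Proof.
have [N hN] : exists N : nat, level xi < N%:R.
  by exists (Num.bound `|level xi|); apply: le_lt_trans (ler_norm _) _;
     apply: archi_boundP.
pose g (d : {ffun pos_roots r -> 'I_N.+1}) : {ffun pos_roots r -> nat} :=
  [ffun a => d a : nat].
apply: (@sub_finite_set _ _ (g @` setT)%classic); last first.
  exact/finite_image/finite_finset.
move=> c /= hc; exists [ffun a => inord (c a)] => //.
apply/ffunP => a; rewrite !ffunE inordK //.
have lev_ge0 b : 0 <= level (val b *+ c b).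
  rewrite levelMn mulrn_wge0 //.
  by apply: le_trans ler01 _; apply: level_pos_roots (valP b).
rewrite ltnS ltnW // -(ltr_nat rat); apply: le_lt_trans hN.
rewrite -hc (big_morph _ (@levelD r) (@level0 r)) (bigD1 a) //=.
rewrite -[leLHS]addr0; apply: lerD; last by apply: sumr_ge0 => b _; apply: lev_ge0.
rewrite levelMn ler_wMn2r //.
exact: level_pos_roots (valP a).
Qed.

(* Main.v *)
Require Import Defs.
From mathcomp Require Import all_boot all_order all_fingroup all_algebra finmap.
From mathcomp Require Import boolp classical_sets functions cardinality.
From mathcomp Require Import zify ring lra.

Set Implicit Arguments.
Unset Strict Implicit.
Unset Printing Implicit Defensive.

Import Order.TTheory GRing.Theory Num.Theory.

(** An element of the alternation set is determined by where it sends
    highest_root + rho, so the elements can be counted through the coordinate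
    sequences of the images.  With rank m + 2 and h_j = j + 1/2,

      highest_root + rho = (h_{m+2}, h_{m+1}, h_{m-1}, ..., h_0),
      varpi1 + rho       = (h_{m+2}, h_m,     h_{m-1}, ..., h_0)

    ([coords_highest_root_rho], [coords_varpi1_rho]).  The Weyl group is the
    group of signed permutations of the coordinates ([weyl_groupP]) and the
    entries above are distinct and positive, so the orbit of
    highest_root + rho is free and consists of the sequences whose absolute
    values rearrange the first line.  A vector is a sum of positive roots iff
    its coefficients on the simple roots, which are its partial sums of
    coordinates, are natural numbers ([root_sumP]).  Integrality is automatic
    here because all entries are half-odd, so what is being counted is: signed
    rearrangements of the first line whose partial sums dominate those of the
    second ([alternation_set_coords]).

    Such sequences are found greedily, keeping track of the slack, that is, the
    excess of the partial sum so far.  The first entry must be h_{m+2} and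
    leaves slack 0; the second must be h_{m+1} and leaves slack 1.  It remains
    to place (h_{m-1}, ..., h_0) against itself with slack 1.  Either
    the largest value comes first and the slack is unchanged; or the second
    largest comes first, which exhausts the slack and forces the largest to
    follow, restoring slack 1.  This gives the Fibonacci recursion
    E_{m+2} = E_{m+1} + E_m, with E_0 = 1 and E_1 = 2, since with one
    value left the sign of h_0 = 1/2 is free ([mem_admissible_seqs]). *)

(** * Signed rearrangements with dominating partial sums *)

Section Counting.
Local Open Scope ring_scope.

Definition half_odd (j : nat) : rat := j%:R + 2^-1.

Fixpoint staircase (m : nat) : seq rat :=
  if m is m'.+1 then half_odd m' :: staircase m' else [::].

(** [s] is the slack inherited from entries already placed: carrying it along
    makes the domination of partial sums recursive in the first entry. *)
Definition slack_ok (s : rat) (t b : seq rat) : Prop :=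
  forall k, (k <= size t)%N -> 0 <= s + \sum_(i < k) (t`_i - b`_i).

Definition admissible (vals : seq rat) s b t : Prop :=
  perm_eq [seq `|x| | x <- t] vals /\ slack_ok s t b.

(** The two summands of the step are the two possible first entries: the
    largest value, or the second largest immediately followed by the largest. *)
Fixpoint admissible_seqs (m : nat) : seq (seq rat) :=
  match m with
  | 0 => [:: [::]]
  | 1 => [:: [:: half_odd 0]; [:: - half_odd 0]]
  | (m''.+1 as m').+1 =>
      map (cons (half_odd m')) (admissible_seqs m') ++
      map (fun t => [:: half_odd m'', half_odd m' & t]) (admissible_seqs m'')
  end.

Lemma half_odd_gt0 j : 0 < half_odd j.
Proof. by rewrite /half_odd ltr_wpDl. Qed.

Lemma half_oddS j : half_odd j.+1 = half_odd j + 1.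
Proof. by rewrite /half_odd mulrS; ring. Qed.

Lemma staircase_lt m x : x \in staircase m -> x < half_odd m.
Proof.
elim: m => //= m IHm; rewrite inE half_oddS => /predU1P[->|/IHm]; lra.
Qed.

Lemma uniq_staircase m : uniq (staircase m).
Proof.
elim: m => //= m ->; rewrite andbT; apply/negP => /staircase_lt.
by rewrite ltxx.
Qed.

Lemma slack_ok_nil s : slack_ok s [::] [::] <-> 0 <= s.
Proof.
split=> [/(_ 0%N isT)|s0 k]; first by rewrite big_ord0 addr0.
by rewrite leqn0 => /eqP->; rewrite big_ord0 addr0.
Qed.

Lemma slack_ok_cons s x t y b :
  slack_ok s (x :: t) (y :: b) <-> 0 <= s /\ slack_ok (s + x - y) t b.
Proof.
have sumE k : s + \sum_(i < k.+1) ((x :: t)`_i - (y :: b)`_i) =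
    (s + x - y) + \sum_(i < k) (t`_i - b`_i).
  by rewrite big_ord_recl /=; ring.
split=> [ok | [s0 ok] [|k] kt].
- split; first by have := ok 0%N isT; rewrite big_ord0 addr0.
  by move=> k kt; rewrite -sumE; apply: ok.
- by rewrite big_ord0 addr0.
- by rewrite sumE; apply: ok.
Qed.

Lemma slack_ok_ge0 s t b : slack_ok s t b -> 0 <= s.
Proof. by move=> /(_ 0%N (leq0n _)); rewrite big_ord0 addr0. Qed.

Lemma size_admissible vals s b t : admissible vals s b t -> size t = size vals.
Proof. by case=> /perm_size; rewrite size_map. Qed.

Lemma admissible_cons vals s b x y t : 0 <= s ->
  admissible (`|x| :: vals) s (y :: b) (x :: t) <->
  admissible vals (s + x - y) b t.
Proof.
move=> s0; rewrite /admissible slack_ok_cons /= perm_cons.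
by split=> [[? []]|[]].
Qed.

Lemma admissible_head vals s b y t : size vals != 0%N ->
  admissible vals s (y :: b) t ->
  exists x t', [/\ t = x :: t', `|x| \in vals & y - s <= x].
Proof.
move=> vals0 adm; have := size_admissible adm; case: adm.
case: t => [_ _ /esym/eqP/idPn//|x t vperm /slack_ok_cons[s0 ok] _].
exists x, t; split=> //; first by rewrite -(perm_mem vperm) mem_head.
have := slack_ok_ge0 ok; lra.
Qed.

(** With no slack the first entry must be at least [y], and only [x] is that
    large. *)
Lemma admissible_forced x y vals b t : 0 < y <= x ->
    {in vals, forall z, z < y} ->
  admissible (x :: vals) 0 (y :: b) t <->
  exists2 t', t = x :: t' & admissible vals (x - y) b t'.
Proof.
move=> /andP[y0 yx] lty; have x0 : 0 < x by lra.
have conv t' : admissible (x :: vals) 0 (y :: b) (x :: t') <->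
    admissible vals (x - y) b t'.
  by rewrite -{1}(gtr0_norm x0) admissible_cons // add0r.
split=> [adm|[t' -> /conv]//].
have [//|z [t' [tE zvals yz]]] := admissible_head _ adm.
have zx : z = x.
  have zn : `|z| = z by rewrite ger0_norm //; lra.
  by move: zvals; rewrite zn inE => /predU1P[//|/lty]; lra.
by exists t'; rewrite tE zx // in adm *; apply/conv.
Qed.

(** This state is met twice: after the first entry of the whole problem, and
    whenever the second largest remaining value has been placed first, the
    bounds being one step behind the largest value in both cases. *)
Lemma admissible_exhausted m t :
  admissible (half_odd m.+1 :: staircase m) 0 (half_odd m :: staircase m) t <->
  exists2 t', t = half_odd m.+1 :: t' & admissible (staircase m) 1 (staircase m) t'.
Proof.
have -> : 1 = half_odd m.+1 - half_odd m by rewrite half_oddS; ring.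
apply: admissible_forced; last exact: staircase_lt.
by rewrite half_odd_gt0 half_oddS lerDl.
Qed.

(** The first entry is at least the largest value minus 1, hence positive (when
    two values or more remain) and one of the two largest.  Choosing the second
    largest brings the slack to 0, and [admissible_exhausted] then gives the next
    entry. *)
Lemma mem_admissible_seqs m t :
  t \in admissible_seqs m <-> admissible (staircase m) 1 (staircase m) t.
Proof.
suff: (forall t, t \in admissible_seqs m <->
         admissible (staircase m) 1 (staircase m) t) /\
      (forall t, t \in admissible_seqs m.+1 <->
         admissible (staircase m.+1) 1 (staircase m.+1) t) by case.
elim: m {t} => [|m [IHm IHm1]]; split=> // t.
- rewrite inE; split=> [/eqP->|/size_admissible/size0nil->//].
  by split=> //; apply/slack_ok_nil.
- rewrite [staircase _]/= [admissible_seqs _]/=.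
  have: half_odd 0 = 2^-1 by rewrite /half_odd add0r.
  (* Both signs of h = 1/2 fit: choosing - h costs exactly the slack 1. *)
  move: (half_odd 0) => h hE; have hn : `|h| = h by rewrite ger0_norm; lra.
  rewrite !inE; split=> [|adm].
    case/orP=> /eqP->; (split; first by rewrite /= ?normrN hn).
      by apply/slack_ok_cons; split=> //; apply/slack_ok_nil; lra.
    by apply/slack_ok_cons; split=> //; apply/slack_ok_nil; lra.
  have [//|x [t' [tE xin _]]] := admissible_head _ adm.
  move: (size_admissible adm); rewrite tE => -[/size0nil t'0].
  by rewrite t'0 !eqseq_cons eqxx !andbT -eqr_norm2 hn -mem_seq1.
- pose a := half_odd m.+1; pose b := half_odd m.
  have aE : a = b + 1 by apply: half_oddS.
  have b0 : 0 < b by apply: half_odd_gt0.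
  have an : `|a| = a by rewrite gtr0_norm //; lra.
  have bn : `|b| = b by rewrite gtr0_norm //; lra.
  have swap t' : admissible [:: a, b & staircase m] 1 [:: a, b & staircase m] t'
      <-> admissible [:: b, a & staircase m] 1 [:: a, b & staircase m] t'.
    rewrite /admissible; suff /permPr-> : perm_eq [:: a, b & staircase m]
      [:: b, a & staircase m] by [].
    by rewrite (perm_catCA [:: a] [:: b]).
  have keep t' : admissible [:: a, b & staircase m] 1 [:: a, b & staircase m]
      (a :: t') <-> admissible (b :: staircase m) 1 (b :: staircase m) t'.
    by rewrite -{1}an admissible_cons // addrK.
  have drop t' : admissible [:: b, a & staircase m] 1 [:: a, b & staircase m]
      (b :: t') <-> admissible (a :: staircase m) 0 (b :: staircase m) t'.
    by rewrite -{1}bn admissible_cons //; have -> : 1 + b - a = 0 by lra.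
  rewrite [admissible_seqs _]/= mem_cat -/a -/b; split.
    case/orP=> /mapP[t' t'E ->].
      by apply/keep/IHm1.
    apply/swap/drop/admissible_exhausted; exists t' => //; exact/IHm.
  rewrite -/(staircase m.+2) => adm.
  have [//|x [t' [tE xin xge]]] := admissible_head _ adm.
  have xn : `|x| = x by rewrite ger0_norm // -/a; move: xge; rewrite -/a; lra.
  rewrite {}tE in adm *; move: xin; rewrite xn inE -/a => /predU1P[xa|].
    rewrite xa in adm *; rewrite map_f //; first exact/IHm1/keep.
  rewrite inE -/b => /predU1P[xb|/staircase_lt]; last first.
    by move: xge; rewrite -/a -/b; lra.
  rewrite xb in adm *.
  have /admissible_exhausted[t'' -> /IHm t''E] := (drop _).1 ((swap _).1 adm).
  by apply/orP; right; apply/mapP; exists t''.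
Qed.

Lemma size_admissible_seqs m : size (admissible_seqs m) = fib m.+2.
Proof.
suff: size (admissible_seqs m) = fib m.+2 /\
      size (admissible_seqs m.+1) = fib m.+3 by case.
elim: m => // m [IHm IHm1]; split=> //.
by rewrite [admissible_seqs _]/= size_cat !size_map IHm IHm1.
Qed.

Lemma uniq_admissible_seqs m : uniq (admissible_seqs m).
Proof.
suff: uniq (admissible_seqs m) /\ uniq (admissible_seqs m.+1) by case.
elim: m => [|m [IHm IHm1]]; split=> //.
rewrite [admissible_seqs _]/= cat_uniq !map_inj_uniq; first last.
- by move=> ? ? [].
- by move=> ? ? [].
rewrite IHm IHm1 andbT /=; apply/hasPn => _ /mapP[t _ ->].
by apply/negP => /mapP[t' _ [+ _]]; rewrite half_oddS; lra.
Qed.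

End Counting.

(** * The Weyl group as signed permutations *)

Section Roots.
Local Open Scope ring_scope.
Variable r : nat.
Implicit Types (i j k : 'I_r) (u v : 'rV[rat]_r).

Lemma epsE i k : eps r i 0 k = (k == i)%:R.
Proof. by rewrite mxE. Qed.

(** This lets the last simple root, which is short, be treated like the others:
    see [simple_rootE]. *)
Lemma eps_outside n : (r <= n)%N -> eps r n = 0.
Proof.
move=> rn; apply/rowP => k; rewrite !mxE; case: eqP => // kn.
by have := ltn_ord k; rewrite kn ltnNge rn.
Qed.

Lemma pos_rootsP (a : 'rV[rat]_r) :
  reflect [\/ exists2 p : 'I_r * 'I_r, (p.1 < p.2)%N & a = eps r p.1 - eps r p.2,
              exists2 p : 'I_r * 'I_r, (p.1 < p.2)%N & a = eps r p.1 + eps r p.2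
            | exists i, a = eps r i]
    (a \in pos_roots r).
Proof.
rewrite !in_fsetU; apply: (iffP idP).
  by case/orP=> [/orP[]|] /imfsetP[p /= pP ->];
    [constructor 1; exists p | constructor 2; exists p | constructor 3; exists p].
case=> [[p pP ->]|[p pP ->]|[i ->]].
- by apply/orP; left; apply/orP; left; apply/imfsetP; exists p.
- by apply/orP; left; apply/orP; right; apply/imfsetP; exists p.
- by apply/orP; right; apply/imfsetP; exists i.
Qed.

Lemma dot_eps v i : dot v (eps r i) = v 0 i.
Proof.
rewrite /dot (bigD1 i) //= epsE eqxx mulr1 big1 ?addr0 // => k ki.
by rewrite epsE (negbTE ki) mulr0.
Qed.

Lemma dotDr u v w : dot w (u + v) = dot w u + dot w v.
Proof. by rewrite /dot -big_split; apply: eq_bigr => i _; rewrite mxE mulrDr. Qed.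

Lemma dotNr u v : dot u (- v) = - dot u v.
Proof. by rewrite /dot -sumrN; apply: eq_bigr => i _; rewrite mxE mulrN. Qed.

Definition signed_perm (p : 'S_r) (e : pred 'I_r) v : 'rV[rat]_r :=
  \row_i ((-1) ^+ e i * v 0 (p i)).

Lemma signed_perm1 : signed_perm 1 xpred0 = id.
Proof. by apply/funext => v; apply/rowP => i; rewrite mxE mul1r perm1. Qed.

Lemma signed_perm_comp p e q f :
  signed_perm p e \o signed_perm q f =
  signed_perm (p * q) (fun i => e i (+) f (p i)).
Proof.
apply/funext => v; apply/rowP => i.
by rewrite /= !mxE permM mulrA signr_addb.
Qed.

Lemma reflection_eps i : reflection (eps r i) = signed_perm 1 (xpred1 i).
Proof.
apply/funext => v; apply/rowP => k.
rewrite !mxE !dot_eps epsE eqxx perm1 divr1 val_eqE.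
by case: eqVneq => [->|_] /=; rewrite ?expr1 ?expr0; ring.
Qed.

Lemma reflection_epsB i j : i != j ->
  reflection (eps r i - eps r j) = signed_perm (tperm i j) xpred0.
Proof.
move=> ij; apply/funext => v; apply/rowP => k.
rewrite !mxE !(dotDr, dotNr) !dot_eps !mxE !eqxx !val_eqE (eq_sym j i) (negbTE ij).
case: tpermP => [->|->|/eqP/negbTE-> /eqP/negbTE->].
- by rewrite eqxx (negbTE ij) expr0; field.
- by rewrite eqxx (eq_sym j i) (negbTE ij) expr0; field.
- by rewrite expr0; field.
Qed.

Lemma reflection_epsD i j : i != j ->
  reflection (eps r i + eps r j) = signed_perm (tperm i j) (pred2 i j).
Proof.
move=> ij; apply/funext => v; apply/rowP => k.
rewrite !mxE !(dotDr, dotNr) !dot_eps !mxE !eqxx !val_eqE (eq_sym j i) (negbTE ij) /=.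
case: tpermP => [->|->|/eqP/negbTE-> /eqP/negbTE->].
- by rewrite eqxx (negbTE ij) /= expr1; field.
- by rewrite eqxx (eq_sym j i) (negbTE ij) /= expr1; field.
- by rewrite /= expr0; field.
Qed.

Lemma weyl_group_comp (w x : 'rV[rat]_r -> 'rV[rat]_r) :
  weyl_group w -> weyl_group x -> weyl_group (w \o x).
Proof.
elim=> [//|a w' aP _ IH] xW.
by apply: (weyl_reflection aP (w := w' \o x)); apply: IH.
Qed.

Lemma weyl_group_reflection a : a \in pos_roots r -> weyl_group (reflection a).
Proof. by move=> aP; apply: (weyl_reflection aP (weyl_id r)). Qed.

(** Sign changes are products of reflections in the short roots. *)
Lemma weyl_group_signs (e : pred 'I_r) : weyl_group (signed_perm 1 e).
Proof.
suff signsW (s : seq 'I_r) : uniq s -> weyl_group (signed_perm 1 (fun i => i \in s)).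
  have -> : e = (fun i => i \in enum e) by apply/funext => i; rewrite mem_enum.
  exact/signsW/enum_uniq.
elim: s => [_|i s IHs /= /andP[iNs us]].
  by rewrite [signed_perm _ _]signed_perm1; apply: weyl_id.
rewrite [signed_perm _ _](_ : _ =
    reflection (eps r i) \o signed_perm 1 (fun i => i \in s)).
  by apply: weyl_reflection (IHs us); apply/pos_rootsP; constructor 3; exists i.
rewrite reflection_eps signed_perm_comp mulg1; congr signed_perm.
apply/funext => k /=; rewrite perm1 inE.
by case: eqVneq => [->|//]; rewrite (negbTE iNs).
Qed.

Lemma weyl_group_tperm i j : weyl_group (signed_perm (tperm i j) xpred0).
Proof.
wlog ij : i j / (i < j)%N.
  move=> IH; case: (ltngtP i j) => [/IH//|/IH|/val_inj->]; first by rewrite tpermC.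
  by rewrite tperm1 signed_perm1; apply: weyl_id.
rewrite -reflection_epsB; last by rewrite neq_ltn ij.
apply: weyl_group_reflection; apply/pos_rootsP.
by constructor 1; exists (i, j).
Qed.

(** Reflections in roots permute the coordinates up to sign; conversely a signed
    permutation is a product of transpositions (reflections in the roots
    eps i - eps j) followed by sign changes. *)
Lemma weyl_groupP (w : 'rV[rat]_r -> 'rV[rat]_r) :
  weyl_group w <-> exists p e, w = signed_perm p e.
Proof.
split=> [|[p [e ->]]].
  elim=> [|a w' aP _ [p [e ->]]]; first by exists 1%g, xpred0; rewrite signed_perm1.
  suff [q [f ->]] : exists q f, reflection a = signed_perm q f.
    by rewrite signed_perm_comp; do 2!eexists.
  have ne (x : 'I_r * 'I_r) : (x.1 < x.2)%N -> x.1 != x.2.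
    by move=> x12; rewrite neq_ltn x12.
  case/pos_rootsP: aP => [[x /ne xP ->]|[x /ne xP ->]|[i ->]].
  - by rewrite reflection_epsB //; do 2!eexists.
  - by rewrite reflection_epsD //; do 2!eexists.
  - by rewrite reflection_eps; do 2!eexists.
rewrite [signed_perm p e](_ : _ = signed_perm 1 e \o signed_perm p xpred0); last first.
  rewrite signed_perm_comp mul1g; congr signed_perm.
  by apply/funext => i; rewrite addbF.
apply: weyl_group_comp (weyl_group_signs e) _.
have [ts -> _] := prod_tpermP p.
elim: ts => [|t ts IHts]; first by rewrite big_nil signed_perm1; apply: weyl_id.
rewrite big_cons.
rewrite (_ : signed_perm _ _ = signed_perm (tperm t.1 t.2) xpred0 \o
  signed_perm (\prod_(t <- ts) tperm t.1 t.2)%g xpred0).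
  exact: weyl_group_comp (weyl_group_tperm _ _) IHts.
by rewrite signed_perm_comp.
Qed.

Definition coords v : seq rat := [tuple v 0 i | i < r].

Lemma nth_coords v i : (coords v)`_i = v 0 i.
Proof. by rewrite -tnth_nth tnth_mktuple. Qed.

Lemma coords_inj : injective coords.
Proof. by move=> u v uv; apply/rowP => i; rewrite -!nth_coords uv. Qed.

(** Absolute values recover the permutation, because the entries of [v] are
    positive and distinct, and then the signs can be read off. *)
Lemma signed_perm_regular v p e q f :
    {in coords v, forall x, 0 < x} -> uniq (coords v) ->
  signed_perm p e v = signed_perm q f v -> signed_perm p e = signed_perm q f.
Proof.
move=> vpos vuniq /rowP pqv.
have v_gt0 i : 0 < v 0 i by apply: vpos; rewrite -nth_coords mem_nth ?size_tuple.
have v_inj i j : v 0 i = v 0 j -> i = j.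
  by have /tuple_uniqP inj := vuniq; move=> vij; apply: inj; rewrite !tnth_mktuple.
have pqE i : p i = q i.
  apply: v_inj; have := congr1 Num.norm (pqv i).
  by rewrite !mxE !normrMsign !gtr0_norm.
apply/funext => u; apply/rowP => i.
rewrite !mxE -pqE; congr (_ * _); have := pqv i; rewrite !mxE -pqE.
exact/mulIf/lt0r_neq0.
Qed.

Lemma weyl_orbitP v x : {in coords v, forall x, 0 <= x} ->
  (exists2 w, weyl_group w & w v = x) <->
  perm_eq [seq `|y| | y <- coords x] (coords v).
Proof.
move=> vpos; have v_ge0 i : 0 <= v 0 i.
  by apply: vpos; rewrite -nth_coords mem_nth ?size_tuple.
have absE : [seq `|y| | y <- coords x] = [tuple `|x 0 i| | i < r].
  by rewrite -map_comp.
split=> [[w /weyl_groupP[p [e ->]] <-]|].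
  rewrite /coords -map_comp; apply/tuple_permP; exists p.
  by apply: eq_map => i /=; rewrite tnth_mktuple mxE normrMsign ger0_norm.
rewrite absE => /tuple_permP[p /val_inj/(congr1 (@tnth _ _))/funeqP absx].
exists (signed_perm p (fun i => x 0 i < 0)).
  by apply/weyl_groupP; do 2!eexists.
apply/rowP => i; have := absx i; rewrite !tnth_mktuple => vE.
by rewrite mxE -vE -realEsign ?num_real.
Qed.

End Roots.

(** * Positivity of the partition function *)

Section Kostant.
Local Open Scope ring_scope.
Variable r : nat.
Implicit Types (i j k : 'I_r) (u v xi : 'rV[rat]_r).

(** Over the first [n] coordinates this is the coefficient on the simple root
    of index [n - 1]: see [sum_simple_root]. *)
Definition psum v n : rat := \sum_(i < n) (coords v)`_i.

Lemma size_coords v : size (coords v) = r.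
Proof. exact: size_tuple. Qed.

Lemma nth_coords_default v n : (r <= n)%N -> (coords v)`_n = 0.
Proof. by move=> rn; rewrite nth_default ?size_coords. Qed.

Lemma nth_coordsD u v n : (coords (u + v))`_n = (coords u)`_n + (coords v)`_n.
Proof.
have [rn|nr] := leqP r n; first by rewrite !nth_coords_default ?addr0.
by rewrite !(nth_coords _ (Ordinal nr)) mxE.
Qed.

Lemma nth_coordsN v n : (coords (- v))`_n = - (coords v)`_n.
Proof.
have [rn|nr] := leqP r n; first by rewrite !nth_coords_default ?oppr0.
by rewrite !(nth_coords _ (Ordinal nr)) mxE.
Qed.

Lemma psumD n : {morph psum^~ n : u v / u + v}.
Proof.
move=> u v; rewrite /psum -big_split; apply: eq_bigr => i _.
exact: nth_coordsD.
Qed.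

Lemma psumN n : {morph psum^~ n : v / - v}.
Proof.
move=> v; rewrite /psum -sumrN; apply: eq_bigr => i _; exact: nth_coordsN.
Qed.

Lemma psum_vec0 n : psum 0 n = 0.
Proof. by apply: (addrI (psum 0 n)); rewrite -psumD !addr0. Qed.

Lemma psum0 v : psum v 0 = 0.
Proof. exact: big_ord0. Qed.

Lemma psumS v n : psum v n.+1 = psum v n + (coords v)`_n.
Proof. exact: big_ord_recr. Qed.

Lemma psum_eps i n : psum (eps r i) n = (i < n)%:R.
Proof.
elim: n => [|n IHn]; first by rewrite psum0.
rewrite psumS IHn ltnS [in RHS]leq_eqVlt.
have [rn|nr] := leqP r n.
  by rewrite nth_coords_default // addr0 (ltn_eqF (leq_trans (ltn_ord i) rn)).
rewrite (nth_coords _ (Ordinal nr)) epsE -val_eqE /= eq_sym.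
by case: ltngtP => //= _; rewrite ?addr0 ?add0r.
Qed.

Lemma psum_pos_root a n : a \in pos_roots r -> psum a n \in Num.nat.
Proof.
case/pos_rootsP => [[p p12 ->]|[p p12 ->]|[i ->]].
- rewrite psumD psumN !psum_eps -natrB ?natr_nat //.
  by case: (ltnP p.2 n) => // /(ltn_trans p12)->.
- by rewrite psumD !psum_eps rpredD ?natr_nat.
- by rewrite psum_eps natr_nat.
Qed.

Lemma simple_rootE i : simple_root i = eps r i - eps r i.+1.
Proof.
rewrite /simple_root; case: eqP => // ir.
by rewrite (@eps_outside r i.+1) ?subr0 // ir.
Qed.

Lemma simple_root_pos i : simple_root i \in pos_roots r.
Proof.
rewrite /simple_root; apply/pos_rootsP; case: eqP => [_|/eqP ir].
  by constructor 3; exists i.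
have ir1 : (i.+1 < r)%N by rewrite ltn_neqAle ir ltn_ord.
by constructor 1; exists (i, Ordinal ir1).
Qed.

Lemma row_sum_eps v : v = \sum_(i < r) v 0 i *: eps r i.
Proof.
apply/rowP => k; rewrite summxE (bigD1 k) //= mxE epsE eqxx mulr1 big1 ?addr0 //.
by move=> i ik; rewrite mxE epsE eq_sym (negbTE ik) mulr0.
Qed.

(** Abel summation, with the boundary terms killed by [psum v 0 = 0] and by the
    vanishing of [eps r r]. *)
Lemma sum_simple_root v : v = \sum_(k < r) psum v k.+1 *: simple_root k.
Proof.
pose f n := psum v n *: eps r n.
rewrite (eq_bigr (fun k : 'I_r => v 0 k *: eps r k - (f k.+1 - f k))).
  rewrite sumrB -row_sum_eps -(big_mkord xpredT (fun n => f n.+1 - f n)).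
  by rewrite telescope_sumr // /f psum0 (@eps_outside r r) // scale0r scaler0 !subr0.
move=> k _; rewrite simple_rootE /f psumS nth_coords scalerBr scalerDl.
by rewrite opprB addrA [v 0 k *: _ + _]addrC.
Qed.

Definition root_sum xi := exists c, root_partitions xi c.

Lemma root_sum0 : root_sum 0.
Proof.
by exists [ffun=> 0%N]; rewrite /root_partitions /= big1 // => a _; rewrite ffunE.
Qed.

Lemma root_sumD u v : root_sum u -> root_sum v -> root_sum (u + v).
Proof.
move=> [c cu] [d dv]; exists [ffun a => (c a + d a)%N].
rewrite /root_partitions /= -cu -dv -big_split; apply: eq_bigr => a _.
by rewrite ffunE mulrnDr.
Qed.

Lemma root_sum_root a : a \in pos_roots r -> root_sum a.
Proof.
move=> aP; exists [ffun b => (b == [` aP]%fset : nat)].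
rewrite /root_partitions /= (bigD1 [` aP]%fset) //= ffunE eqxx mulr1n big1 ?addr0 //.
by move=> b ba; rewrite ffunE (negbTE ba).
Qed.

Lemma kostant_gt0 xi : (0 < kostant xi)%N <-> root_sum xi.
Proof.
rewrite /kostant cardfs_gt0; split.
  case/fset0Pn => c; rewrite in_fset_set ?inE; last exact: root_partitions_finite.
  by move=> ?; exists c.
case=> c cP; apply/fset0Pn; exists c.
by rewrite in_fset_set ?inE //; apply: root_partitions_finite.
Qed.

(** Partial sums are additive and natural on each positive root; conversely the
    partial sums are the multiplicities of a decomposition into simple roots. *)
Lemma root_sumP xi :
  root_sum xi <-> forall n, (n <= r)%N -> psum xi n \in Num.nat.
Proof.
split=> [[c <-] n _|nat_psum].
  rewrite (big_morph _ (@psumD n) (psum_vec0 n)) rpred_sum // => a _.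
  elim: (c a) => [|m IHm]; first by rewrite mulr0n psum_vec0.
  by rewrite mulrS psumD; apply: rpredD IHm; apply: psum_pos_root (valP a).
rewrite [xi]sum_simple_root; apply: big_ind => [||k _].
- exact: root_sum0.
- exact: root_sumD.
have /natrP[m ->] := nat_psum k.+1 (ltn_ord k).
rewrite scaler_nat; elim: m => [|m IHm]; first exact: root_sum0.
by rewrite mulrS; apply: root_sumD IHm; apply/root_sum_root/simple_root_pos.
Qed.

Lemma kostant_subr_gt0 u v :
    (forall i, u 0 i - v 0 i \is a Num.int) ->
  (0 < kostant (u - v))%N <-> slack_ok 0 (coords u) (coords v).
Proof.
move=> uv_int; rewrite kostant_gt0 root_sumP.
have psumE n : psum (u - v) n = 0 + \sum_(i < n) ((coords u)`_i - (coords v)`_i).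
  by rewrite add0r; apply: eq_bigr => i _; rewrite nth_coordsD nth_coordsN.
have psum_int n : psum (u - v) n \is a Num.int.
  apply: rpred_sum => i _.
  have [rn|nr] := leqP r i; first by rewrite nth_coords_default.
  by rewrite (nth_coords _ (Ordinal nr)) !mxE uv_int.
rewrite /slack_ok size_coords; split=> ok n /ok; rewrite -psumE natrEint.
  by case/andP.
by rewrite psum_int => ->.
Qed.

End Kostant.

(** * The vectors rho, varpi1 and highest_root *)

Section Weights.
Local Open Scope ring_scope.

Lemma big_fsetU_disjoint (V : nmodType) (T : choiceType) (A B : {fset T})
    (F : T -> V) : {in A, forall x, x \notin B} ->
  \sum_(x <- (A `|` B)%fset) F x = \sum_(x <- A) F x + \sum_(x <- B) F x.
Proof.
move=> dAB; rewrite -big_cat; apply: perm_big; apply: uniq_perm.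
- exact: fset_uniq.
- rewrite cat_uniq !fset_uniq andbT /=; apply/hasPn => x xB.
  by apply/negP => /dAB; rewrite xB.
- by move=> x; rewrite mem_cat in_fsetU.
Qed.

Variable r : nat.
Implicit Types (i j k : 'I_r).

(** The three families of positive roots are disjoint and indexed injectively,
    as a few coordinates of the vectors show. *)
Lemma sum_pos_roots :
  \sum_(a <- pos_roots r) a =
    \sum_(p : 'I_r * 'I_r | (p.1 < p.2)%N) (eps r p.1 - eps r p.2) +
    \sum_(p : 'I_r * 'I_r | (p.1 < p.2)%N) (eps r p.1 + eps r p.2) +
    \sum_(i < r) eps r i.
Proof.
have ne (p : 'I_r * 'I_r) :
    p \in [pred p : 'I_r * 'I_r | (p.1 < p.2)%N] -> (p.1 == p.2) = false.
  by rewrite inE => p12; rewrite -val_eqE ltn_eqF.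
rewrite /pos_roots !big_fsetU_disjoint; first last.
- move=> a; rewrite in_fsetU => /orP[] /imfsetP[p /ne p12 ->];
    apply/imfsetP => -[q /= _ /rowP E].
    have := E p.2; rewrite !mxE !val_eqE eqxx eq_sym p12; case: eqP => _ /=; lra.
  have := E p.1; have := E p.2; rewrite !mxE !val_eqE !eqxx (eq_sym p.2) p12.
  case: eqP => [<-|_] /=; last by lra.
  by rewrite p12 /=; lra.
- move=> a /imfsetP[p /ne p12 ->]; apply/imfsetP => -[q /= _ /rowP/(_ p.2)].
  rewrite !mxE !val_eqE eqxx eq_sym p12; do 2!case: eqP => _ /=; lra.
rewrite !big_imfset /=; first by rewrite !big_enum.
- move=> i j _ _ /rowP/(_ i); rewrite !mxE !val_eqE eqxx.
  by case: eqP => //= _; lra.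
- move=> [i j] [i' j'] /= ij ij' /rowP E.
  have := E i; have := E j; rewrite !mxE !val_eqE !eqxx (eq_sym j i) (ne (i, j) ij).
  have ne' := ne (i', j') ij'; have lt' : (i' < j')%N := ij'.
  have lt : (i < j)%N := ij.
  case: (eqVneq i i') => [<-|_]; rewrite ?ne' ?(eq_sym j i) ?(ne (i, j) ij) /=.
    by case: (eqVneq j j') => [->//|_]; case: eqP => _ /= *; exfalso; lra.
  have : (i == j') ==> (j != i') && (j != j').
    apply/implyP => /eqP e; apply/andP; split; apply/eqP => e';
      by move: lt lt'; rewrite e e'; lia.
  by case: (i == j'); case: (j == i'); case: (j == j') => //= *; exfalso; lra.
- move=> [i j] [i' j'] /= ij ij' /rowP E.
  have := E i; have := E j; rewrite !mxE !val_eqE !eqxx (eq_sym j i) (ne (i, j) ij).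
  case: (eqVneq i i') => [->|_]; last by case: (i == j') => /= *; exfalso; lra.
  case: (eqVneq j j') => [->//|_]; by case: (j == i') => /= *; exfalso; lra.
Qed.

(** For i < j the roots eps i - eps j and eps i + eps j add up to twice eps i,
    and there are r - i - 1 such j; the short root contributes the final eps i. *)
Lemma rhoE : rho r = \sum_(i < r) half_odd (r - i.+1) *: eps r i.
Proof.
rewrite /rho -(big_seq_fsetE _ _ xpredT id) sum_pos_roots -big_split /=.
rewrite (eq_bigr (fun p : 'I_r * 'I_r => eps r p.1 *+ 2)); last first.
  by move=> p _; rewrite addrACA addNr addr0 mulr2n.
rewrite -(pair_big_dep xpredT (fun i j : 'I_r => (i < j)%N)
  (fun i j => eps r i *+ 2)) -big_split scaler_sumr /=.
apply: eq_bigr => i _.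
rewrite -(big_geq_mkord i.+1 r xpredT (fun=> eps r i *+ 2)).
rewrite sumr_const_nat -mulrnA -mulrSr -scaler_nat scalerA; congr (_ *: _).
by rewrite /half_odd -(natr1 (2 * _)%N) natrM; field.
Qed.

Lemma rho_coord i : rho r 0 i = half_odd (r - i.+1).
Proof.
rewrite rhoE summxE (bigD1 i) //= mxE epsE eqxx mulr1 big1 ?addr0 // => k ki.
by rewrite mxE epsE eq_sym (negbTE ki) mulr0.
Qed.

Lemma varpi1E : varpi1 r = eps r 0.
Proof.
rewrite /varpi1 (eq_bigr (fun i : 'I_r => - (eps r i.+1 - eps r i))); last first.
  by move=> i _; rewrite simple_rootE opprB.
rewrite sumrN -(big_mkord xpredT (fun n => eps r n.+1 - eps r n)).
by rewrite telescope_sumr // opprB (@eps_outside r r) // subr0.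
Qed.

(** This is twice [varpi1] minus the first simple root. *)
Lemma highest_rootE : (0 < r)%N -> highest_root r = eps r 0 + eps r 1.
Proof.
move=> r0; pose o := Ordinal r0.
have restE : \sum_(i < r | i != o) simple_root i = eps r 1.
  have := varpi1E; rewrite /varpi1 (bigD1 o) //= simple_rootE => /(canRL (addKr _)).
  by rewrite opprB subrK => ->.
rewrite /highest_root (bigD1 o) //= mulr1n.
rewrite (eq_bigr (fun i => simple_root i *+ 2)); last first.
  by move=> i; rewrite -val_eqE /= => /negbTE->.
by rewrite sumrMnl restE simple_rootE /= mulr2n addrA subrK.
Qed.

End Weights.

Section ShiftedWeights.
Local Open Scope ring_scope.

Lemma nth_staircase m i : (i < m)%N -> (staircase m)`_i = half_odd (m - i.+1).
Proof.
elim: m i => // m IHm [|i] im; first by rewrite subSS subn0.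
by rewrite subSS -IHm.
Qed.

Lemma size_staircase m : size (staircase m) = m.
Proof. by elim: m => //= m ->. Qed.

Lemma coords_varpi1_rho m :
  coords (varpi1 m.+2 + rho m.+2) = [:: half_odd m.+2, half_odd m & staircase m].
Proof.
apply: (@eq_from_nth _ 0); rewrite size_coords /= ?size_staircase // => i im.
rewrite (nth_coords _ (Ordinal im)) mxE rho_coord varpi1E mxE /= subSS.
case: i im => [|[|i]] im /=; rewrite ?subn0 ?subn1 ?add0r //.
  by rewrite [RHS]half_oddS addrC.
by rewrite nth_staircase.
Qed.

Lemma coords_highest_root_rho m :
  coords (highest_root m.+2 + rho m.+2) =
  [:: half_odd m.+2, half_odd m.+1 & staircase m].
Proof.
apply: (@eq_from_nth _ 0); rewrite size_coords /= ?size_staircase // => i im.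
rewrite (nth_coords _ (Ordinal im)) mxE rho_coord highest_rootE // !mxE /= subSS.
case: i im => [|[|i]] im /=; rewrite ?subn0 ?subn1 ?add0r ?addr0 //.
- by rewrite [RHS]half_oddS addrC.
- by rewrite [RHS]half_oddS addrC.
by rewrite nth_staircase.
Qed.

End ShiftedWeights.

(** * Counting the alternation set *)

Section Main.
Local Open Scope ring_scope.

Definition is_half_odd (x : rat) : bool := x - 2^-1 \is a Num.int.

Lemma half_oddP n : is_half_odd (half_odd n).
Proof. by rewrite /is_half_odd addrK natr_int. Qed.

Lemma is_half_oddN x : is_half_odd (- x) = is_half_odd x.
Proof.
rewrite /is_half_odd -rpredN (_ : - (- x - 2^-1) = (x - 2^-1) + 1); last by field.
by rewrite rpredDr.
Qed.

Lemma is_half_oddB x y : is_half_odd x -> is_half_odd y -> x - y \is a Num.int.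
Proof.
move=> xh yh; rewrite (_ : x - y = (x - 2^-1) - (y - 2^-1)); last by ring.
exact: rpredB.
Qed.

Lemma staircase_half_odd m : all is_half_odd (staircase m).
Proof. by elim: m => //= m ->; rewrite half_oddP. Qed.

Lemma staircase_gt0 m x : x \in staircase m -> 0 < x.
Proof.
by elim: m => //= m IHm; rewrite inE => /predU1P[->|//]; apply: half_odd_gt0.
Qed.

(** Signed permutations keep all coordinates half-odd, so the differences that
    enter the partition function are integral and only the signs of their
    partial sums matter. *)
Lemma mem_alternation_set r (l u : 'rV[rat]_r) w :
    all is_half_odd (coords (l + rho r)) -> all is_half_odd (coords (u + rho r)) ->
  alternation_set l u w <->
  weyl_group w /\ slack_ok 0 (coords (w (l + rho r))) (coords (u + rho r)).
Proof.
move=> l_half u_half.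
suff int_diff : weyl_group w ->
    forall i, w (l + rho r) 0 i - (u + rho r) 0 i \is a Num.int.
  by split=> -[wW ok]; split=> //; apply/(kostant_subr_gt0 (int_diff wW)).
have half v j : all is_half_odd (coords v) -> is_half_odd ((v : 'rV_r) 0 j).
  by move=> /allP; apply; rewrite -nth_coords mem_nth ?size_coords.
move=> /weyl_groupP[p [e ->]] i; apply: is_half_oddB (half _ _ u_half).
rewrite [signed_perm _ _ _ _ _]mxE; have := half _ (p i) l_half.
by case: (e i); rewrite ?mulN1r ?mul1r ?is_half_oddN.
Qed.

Lemma coords_surj r (t : seq rat) : size t = r -> exists x : 'rV_r, coords x = t.
Proof.
move=> tr; exists (\row_i t`_i).
apply: (@eq_from_nth _ 0); rewrite size_coords // => i ir.
by rewrite (nth_coords _ (Ordinal ir)) mxE.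
Qed.

Lemma alternation_set_coords r (l u : 'rV[rat]_r) :
    all is_half_odd (coords (l + rho r)) -> all is_half_odd (coords (u + rho r)) ->
    {in coords (l + rho r), forall x, 0 < x} ->
  ((fun w => coords (w (l + rho r))) @` alternation_set l u =
   [set t | admissible (coords (l + rho r)) 0 (coords (u + rho r)) t])%classic.
Proof.
move=> l_half u_half l_gt0.
have orbitP x := weyl_orbitP x (fun y yl => ltW (l_gt0 y yl)).
rewrite eqEsubset; split=> t /=.
  move=> [w /(mem_alternation_set _ l_half u_half)[wW ok] <-]; split=> //.
  by apply/orbitP; exists w.
move=> tadm; have := size_admissible tadm; rewrite size_coords.
case/coords_surj => x xt; case: tadm; rewrite -xt.
move=> /orbitP[w wW <-] ok; exists w => //.
exact/mem_alternation_set.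
Qed.

Lemma alternation_set_inj r (l u : 'rV[rat]_r) :
    uniq (coords (l + rho r)) -> {in coords (l + rho r), forall x, 0 < x} ->
  {in alternation_set l u &, injective (fun w => coords (w (l + rho r)))}.
Proof.
move=> l_uniq l_gt0 w w'; rewrite !inE => -[wW _] [wW' _] /coords_inj.
case/weyl_groupP: wW => p [e ->]; case/weyl_groupP: wW' => q [f ->].
exact: signed_perm_regular.
Qed.

(** The first two entries are forced, as no slack is available, and the second
    gains slack 1. *)
Lemma admissible_highest_root m t :
  admissible [:: half_odd m.+2, half_odd m.+1 & staircase m] 0
             [:: half_odd m.+2, half_odd m & staircase m] t <->
  t \in [seq [:: half_odd m.+2, half_odd m.+1 & t'] | t' <- admissible_seqs m].
Proof.
have h n : half_odd n < half_odd n.+1 by rewrite half_oddS; lra.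
rewrite admissible_forced ?subrr ?half_odd_gt0 ?lexx //; last first.
  by move=> x; rewrite inE => /predU1P[->|/staircase_lt]; have := h m;
    have := h m.+1; lra.
split=> [[t' -> /admissible_exhausted[t'' -> /mem_admissible_seqs t''E]]|].
  exact: map_f.
case/mapP=> t' /mem_admissible_seqs t'E ->; eexists; first by [].
by apply/admissible_exhausted; exists t'.
Qed.

End Main.

Theorem corollary8p4 (r : nat) (hr : (2 <= r)%N) :
  (alternation_set (highest_root r) (varpi1 r) #= `I_(fib r))%card.
Proof.
case: r hr => [|[|m]] // _.
have lE := coords_highest_root_rho m; have uE := coords_varpi1_rho m.
have l_half : all is_half_odd (coords (highest_root m.+2 + rho m.+2)%R).
  by rewrite lE /= !half_oddP staircase_half_odd.
have u_half : all is_half_odd (coords (varpi1 m.+2 + rho m.+2)%R).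
  by rewrite uE /= !half_oddP staircase_half_odd.
have l_gt0 : {in coords (highest_root m.+2 + rho m.+2)%R, forall x, (0 < x)%R}.
  move=> x; rewrite lE !inE => /or3P[/eqP->|/eqP->|/staircase_gt0//];
    exact: half_odd_gt0.
have l_uniq : uniq (coords (highest_root m.+2 + rho m.+2)%R).
  rewrite lE /= uniq_staircase andbT inE half_oddS.
  apply/andP; split; [apply/norP; split|]; apply/negP.
  - by move/eqP; lra.
  - by move/staircase_lt; rewrite half_oddS; lra.
  - by move/staircase_lt; rewrite half_oddS; lra.
have /card_esym := inj_card_eq (alternation_set_inj (u := varpi1 _) l_uniq l_gt0).
move/card_eq_trans; apply.
rewrite alternation_set_coords // lE uE.
pose S := [seq [:: half_odd m.+2, half_odd m.+1 & t] | t <- admissible_seqs m].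
rewrite (_ : mkset _ = [set` [fset t in S]%fset]%classic); last first.
  rewrite eqEsubset; split=> t /=; rewrite inE /=;
    by move/admissible_highest_root.
apply/card_eq_fsetP; rewrite card_fseq undup_id ?size_map ?size_admissible_seqs //.
rewrite map_inj_uniq ?uniq_admissible_seqs // => t t' [].
by [].
Qed.
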